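(* Let $(\Phi_n)_{n=1}^\infty$ be a non-autonomous iterated function system in $\mathbb{R}^d$. Then for all $n,m,k\in\mathbb{N}$, $$\theta(n,m+k)\le\max\{\theta(n,m),\theta(n+m,k)\}.$$ Suppose moreover that the IFS satisfies the bounded neighbourhood condition. Then there is a constant $C>0$ and an $M\in\mathbb{N}$ such that for all $n,n',m,k\in\mathbb{N}$ with $m\ge M$ and $n\le n'\le n+k$, $$\theta(n,m+k)-\theta(n',m)\le C\frac{k}{m}.$$ In particular (under the bounded neighbourhood condition), the function $\theta:\mathbb{N}\times\mathbb{N}\to\mathbb{R}$ is submaximal.
   Context: **Non-autonomous IFS.** Let $\mathbb{N}=\{1,2,\ldots\}$ and work in Euclidean $\mathbb{R}^d$. For each $n\in\mathbb{N}$ let $\mathcal{J}_n$ be a finite index set with $\#\mathcal{J}_n\ge 2$ and let $\Phi_n=\{S_{n,j}\}_{j\in\mathcal{J}_n}$ be an indexed family of maps $S_{n,j}(x)=r_{n,j}O_{n,j}x+d_{n,j}$ on $\mathbb{R}^d$, where $r_{n,j}\in(0,1)$, $O_{n,j}$ is an orthogonal matrix and $d_{n,j}\in\mathbb{R}^d$. The sequence $(\Phi_n)_{n=1}^\infty$ is a non-autonomous iterated function system (IFS) if there is a non-empty compact set $X\subset\mathbb{R}^d$ with $S_{n,j}(X)\subset X$ for all $n\in\mathbb{N}$, $j\in\mathcal{J}_n$, and $$\lim_{n\to\infty}\sup\{r_{1,j_1}\cdots r_{n,j_n}: j_i\in\mathcal{J}_i,\ i=1,\ldots,n\}=0.$$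 Its limit set is the non-empty compact set $$K=\bigcap_{n=1}^\infty\bigcup_{(j_1,\ldots,j_n)\in\mathcal{J}_1\times\cdots\times\mathcal{J}_n}S_{1,j_1}\circ\cdots\circ S_{n,j_n}(X).$$ **Symbolic space.** Let $\Delta=\prod_{n=1}^\infty\mathcal{J}_n$. For $n\ge 0$, let $\mathcal{T}_n$ be the set of cylinders $[j_1,\ldots,j_n]=\{j_1\}\times\cdots\times\{j_n\}\times\prod_{k>n}\mathcal{J}_k$ with $j_i\in\mathcal{J}_i$ (so $\mathcal{T}_0=\{\Delta\}$), and $\mathcal{T}=\bigcup_{n\ge 0}\mathcal{T}_n$. For $Q=[j_1,\ldots,j_n]$ put $\rho(Q)=r_{1,j_1}\cdots r_{n,j_n}$ (with $\rho(\Delta)=1$), and if $Q\ne\Delta$ let $\widehat{Q}=[j_1,\ldots,j_{n-1}]$ be its parent. For $r>0$ let $\mathcal{T}(r)=\{Q\in\mathcal{T}\setminus\{\Delta\}:\rho(Q)\le r<\rho(\widehat{Q})\}$. The coding map $\pi:\Delta\to\mathbb{R}^d$ is defined by $\{\pi((i_n)_{n=1}^\infty)\}=\bigcap_{n=1}^\infty S_{1,i_1}\circ\cdots\circ S_{n,i_n}(X)$; it satisfies $\pi(\Delta)=K$. **Bounded neighbourhood condition.** For $x\in K$ and $r>0$, let $\mathcal{N}(x,r)=\{Q\in\mathcal{T}(r):\pi(Q)\cap B(x,r)\ne\varnothing\}$, where $B(x,r)$ is the closed ball. The IFS satisfies the bounded neighbourhood condition if $\limsup_{r\to0}\sup_{x\in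 K}\#\mathcal{N}(x,r)<\infty$. **The numbers $\theta(n,m)$.** For $n,m\in\mathbb{N}$ define the pressure $\phi_{n,m}:\mathbb{R}\to\mathbb{R}$ by $$\phi_{n,m}(t)=\frac1m\log\sum_{j_0\in\mathcal{J}_n}\cdots\sum_{j_{m-1}\in\mathcal{J}_{n+m-1}}\prod_{k=0}^{m-1}r_{n+k,j_k}^{\,t}.$$ It is convex, differentiable and strictly decreasing with a unique zero, denoted $\theta(n,m)\ge 0$. **Submaximality.** A function $f:\mathbb{N}\times\mathbb{N}\to\mathbb{R}\cup\{-\infty\}$ is submaximal if (i) for all $x,y,z\in\mathbb{N}$, $f(x,y+z)\le\max\{f(x,y),f(x+y,z)\}$; and (ii) for all $\varepsilon>0$ and $a\in\mathbb{N}$ there is $N=N(\varepsilon,a)$ such that for all $x,x',y,t\in\mathbb{N}$ with $y\ge N$, $t\le a$ and $x\le x'\le x+t$, $f(x,y+t)\le f(x',y)+\varepsilon$. *)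

(* Defs.v *)
From HB Require Import structures.
From mathcomp Require Import all_boot all_order all_algebra.
From mathcomp Require Import all_classical all_reals all_analysis.
Set Implicit Arguments.
Unset Strict Implicit.
Unset Printing Implicit Defensive.
Import Order.TTheory GRing.Theory Num.Theory.
Import numFieldNormedType.Exports.
Local Open Scope classical_set_scope.
Local Open Scope ring_scope.

(* Time indices start at 1: the entries of index 0 below are junk, on which no
   condition is imposed and on which nothing depends.  The metric of R^d is the
   Euclidean one, whereas the norm that the library puts on 'cV[R]_d is the sup
   norm; both give the same (canonical) topology, hence the same compact
   sets. *)

Definition eucl_dist (R : realType) (d : nat) (x y : 'cV[R]_d) : R :=
  Num.sqrt (\sum_i (x i ord0 - y i ord0) ^+ 2).

Definition eucl_closed_ball (R : realType) (d : nat) (x : 'cV[R]_d) (r : R) :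
  set 'cV[R]_d := [set y | eucl_dist x y <= r].

Record sim_seq (R : realType) (d : nat) := SimSeq {
  alphabet : nat -> finType ;
  contraction_ratio : forall n, alphabet n -> R ;
  orth : forall n, alphabet n -> 'M[R]_d ;
  transl : forall n, alphabet n -> 'cV[R]_d }.

Section SimSeq.
Context (R : realType) (d : nat) (Phi : sim_seq R d).

Definition sim n (j : alphabet Phi n) (x : 'cV[R]_d) : 'cV[R]_d :=
  contraction_ratio j *: (orth j *m x) + transl j.

(* Words (j_0, ..., j_{m-1}) with j_k in the alphabet of index n + k. *)
Definition word (n m : nat) : finType :=
  {dffun forall k : 'I_m, alphabet Phi (n + k)}.

Definition rho n m (w : word n m) : R := \prod_(k < m) contraction_ratio (w k).

Definition sim_word n m (w : word n m) : 'cV[R]_d -> 'cV[R]_d :=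
  \big[(fun f g => f \o g)/id]_(k < m) sim (w k).

Definition parent n m (w : word n m) : word n m.-1 :=
  [ffun k : 'I_m.-1 => w (widen_ord (leq_pred m) k)].

Definition pressure (n m : nat) (t : R) : R :=
  m%:R^-1 * ln (\sum_(w : word n m) \prod_(k < m) contraction_ratio (w k) `^ t).

(* The zero of the pressure, which exists and is unique for a non-autonomous
   IFS and n, m >= 1. *)
Definition theta (n m : nat) : R := xget 0 [set t | pressure n m t = 0].

(* The letter of index n of a point of Delta is the value at n.-1. *)
Definition Delta := forall k : nat, alphabet Phi (1 + k).

Definition init_word (i : Delta) (n : nat) : word 1 n :=
  [ffun k : 'I_n => i k].

(* A cylinder is encoded by the word defining it.  For a non-autonomous IFS the
   alphabets have at least two letters, so that distinct words, possibly of
   different lengths, define distinct subsets of Delta. *)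
Definition cylinder : choiceType := {n : nat & word 1 n}.

Definition cylinder_set (Q : cylinder) : set Delta :=
  [set i | init_word i (tag Q) = tagged Q].

Definition cylinder_cut (r : R) : set cylinder :=
  [set Q | [/\ (0 < tag Q)%N, rho (tagged Q) <= r & r < rho (parent (tagged Q))]].

End SimSeq.

Record nonautonomous_IFS (R : realType) (d : nat) := NonautonomousIFS {
  sims :> sim_seq R d ;
  alphabet_ge2 : forall n, (0 < n)%N -> (2 <= #|alphabet sims n|)%N ;
  ratio_in01 : forall n (j : alphabet sims n), (0 < n)%N -> 0 < contraction_ratio j < 1 ;
  orth_orthogonal : forall n (j : alphabet sims n), (0 < n)%N ->
    (orth j)^T *m orth j = 1%:M ;
  seed : set 'cV[R]_d ;
  seed_neq0 : seed !=set0 ;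
  seed_compact : compact seed ;
  seed_stable : forall n (j : alphabet sims n), (0 < n)%N ->
    sim j @` seed `<=` seed ;
  sup_rho_cvg0 : (fun n => sup [set rho w | w in [set: word sims 1 n]]) @ \oo
    --> (0 : R) }.

Section NonautonomousIFS.
Context (R : realType) (d : nat) (Phi : nonautonomous_IFS R d).

(* Neither the limit set nor the coding map depends on the choice of the
   seed. *)
Definition limit_set : set 'cV[R]_d :=
  \bigcap_(n in [set n | (0 < n)%N])
    \bigcup_(w in [set: word Phi 1 n]) (sim_word w @` seed Phi).

(* The intersection is a singleton, of which this is the element. *)
Definition coding (i : Delta Phi) : 'cV[R]_d :=
  xget 0 (\bigcap_(n in [set n | (0 < n)%N])
            (sim_word (init_word i n) @` seed Phi)).

Definition nbhd_cylinders (x : 'cV[R]_d) (r : R) : set (cylinder Phi) :=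
  [set Q | cylinder_cut r Q /\
     (coding @` cylinder_set Q) `&` eucl_closed_ball x r !=set0].

Definition bounded_neighbourhood_condition : Prop :=
  (limf_esup (fun r : R =>
      ereal_sup [set counting (nbhd_cylinders x r) | x in limit_set])
    0^'+ < +oo :> \bar R)%E.

End NonautonomousIFS.

(* The value -oo is allowed, but not +oo. *)
Definition submaximal (R : realType) (f : nat -> nat -> \bar R) : Prop :=
  [/\ forall x y, (0 < x)%N -> (0 < y)%N -> f x y != +oo%E,
      forall x y z, (0 < x)%N -> (0 < y)%N -> (0 < z)%N ->
        (f x (y + z)%N <= maxe (f x y) (f (x + y)%N z))%E &
      forall (eps : R) (a : nat), 0 < eps -> (0 < a)%N ->
        exists2 N : nat, (0 < N)%N &
          forall x x' y t : nat,
            (0 < x)%N -> (0 < x')%N -> (0 < y)%N -> (0 < t)%N ->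
            (N <= y)%N -> (t <= a)%N -> (x <= x' <= x + t)%N ->
            (f x (y + t)%N <= f x' y + eps%:E)%E].

(* Main.v *)
(** Write Z(n,m)(t) for the sum over the words of length m starting at level n
of the t-th powers of their ratios. It is the product of the one-letter sums,
so that Z(n,m+k) = Z(n,m) Z(n+m,k), and theta(n,m) is the solution of Z(n,m) =
1; as Z is strictly decreasing, the maximum inequality follows.

For the second part, let Q be a small cylinder. Its image is covered by c balls
of radius rho(Q)/2, with c depending only on the seed, so by the bounded
neighbourhood condition Q has boundedly many descendants in the cut
T(rho(Q)/2). Each child of Q lies above or in this cut, hence the alphabets
have at most B letters. Likewise, along a branch on which the ratio stays above
rho(Q)/2, every step leaves a sibling that produces a new element of the cut,
hence every word of some fixed length L has ratio at most 1/2. Now raising the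
exponent from theta(n',m) by C k/m, where m >= L, multiplies Z(n',m) = 1 by at
most 2^(-B k) when C = 2 L B, whereas the k additional letters contribute at
most B^k < 2^(B k). *)

Require Import Defs.
From HB Require Import structures.
From mathcomp Require Import all_boot all_order all_algebra.
From mathcomp Require Import all_classical all_reals all_analysis.
From mathcomp Require Import finmap zify lra.
Set Implicit Arguments.
Unset Strict Implicit.
Unset Printing Implicit Defensive.
Import Order.TTheory GRing.Theory Num.Theory.
Import numFieldNormedType.Exports.
Local Open Scope classical_set_scope.
Local Open Scope ring_scope.

(** * Partition sums and the zeros of the pressure *)

Lemma bigA_distr_dffun (R : comPzSemiRingType) (I : finType) (T_ : I -> finType)
    (F : forall i, T_ i -> R) :
  \prod_i \sum_(j : T_ i) F i j =
    \sum_(f : {dffun forall i, T_ i}) \prod_i F i (f i).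
Proof.
pose G i := [ffun j => F i j].
transitivity (\prod_i \sum_(j : T_ i) G i j).
  by apply: eq_bigr => i _; apply: eq_bigr => j _; rewrite ffunE.
(* Tagging each letter with its position makes all sums range over one type, so that ordinary
   distributivity applies; the functions that respect the tags are the dependent ones. *)
under eq_bigr do rewrite (big_tag (fun i => G i)).
rewrite bigA_distr_big_dep -(@big_fprod R 0 1 *%R +%R I T_ G) /=.
rewrite (reindex (@fprod_of_dffun _ T_)) /=; last first.
  exact/onW_bij/fprod_of_dffun_bij.
by apply: eq_bigr => f _; apply: eq_bigr => i _; rewrite fprodE ffunE.
Qed.

Section PartitionFunction.
Context (R : realType) (d : nat) (Phi : nonautonomous_IFS R d).
Implicit Types (n m k : nat) (s t : R).

Definition letter_sum n t : R :=
  \sum_(j : alphabet Phi n) contraction_ratio j `^ t.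

Definition partition_sum n m t : R := \prod_(k < m) letter_sum (n + k) t.

Definition max_ratio n : R :=
  \big[Num.max/0]_(j : alphabet Phi n) contraction_ratio j.

Lemma pressureE n m t : pressure Phi n m t = m%:R^-1 * ln (partition_sum n m t).
Proof. by rewrite /pressure /partition_sum bigA_distr_dffun. Qed.

Lemma partition_sumD n m k t :
  partition_sum n (m + k) t = partition_sum n m t * partition_sum (n + m) k t.
Proof.
rewrite /partition_sum big_split_ord; congr (_ * _).
by apply: eq_bigr => i _; rewrite addnA.
Qed.

Lemma alphabet_inhabited n : (0 < n)%N -> alphabet Phi n.
Proof.
move=> n0.
exact: (@enum_val _ predT (Ordinal (ltnW (@alphabet_ge2 R d Phi n n0)))).
Qed.

Lemma ratio_gt0 n (j : alphabet Phi n) : (0 < n)%N -> 0 < contraction_ratio j.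
Proof. by move=> n0; case/andP: (ratio_in01 j n0). Qed.

Lemma ratio_lt1 n (j : alphabet Phi n) : (0 < n)%N -> contraction_ratio j < 1.
Proof. by move=> n0; case/andP: (ratio_in01 j n0). Qed.

Lemma letter_sum_gt0 n t : (0 < n)%N -> 0 < letter_sum n t.
Proof.
move=> n0; rewrite /letter_sum (bigD1 (alphabet_inhabited n0)) //=.
rewrite ltr_wpDr ?powR_gt0 ?ratio_gt0 // sumr_ge0 // => j _.
exact: powR_ge0.
Qed.

Lemma letter_sum0 n : letter_sum n 0 = #|alphabet Phi n|%:R.
Proof.
rewrite /letter_sum; under eq_bigr do rewrite powRr0.
by rewrite sumr_const.
Qed.

Lemma letter_sum_le_card n t : (0 < n)%N -> 0 <= t ->
  letter_sum n t <= #|alphabet Phi n|%:R.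
Proof.
move=> n0 t0; rewrite -letter_sum0; apply: ler_sum => j _.
by apply: ger_powR => //; rewrite ratio_gt0 ?(ltW (ratio_lt1 _ _)).
Qed.

Lemma ratio_le_max n (j : alphabet Phi n) : contraction_ratio j <= max_ratio n.
Proof. exact: le_bigmax. Qed.

(** At a positive level the alphabet is inhabited and the ratios are positive, so the default 0 of
    the maximum lies below all of them. *)
Lemma max_ratio_attained n : (0 < n)%N ->
  exists j : alphabet Phi n, max_ratio n = contraction_ratio j.
Proof.
move=> n0; rewrite /max_ratio.
have [j _ ->] := @eq_bigmax _ R _ 0 (alphabet_inhabited n0) predT
  (fun j : alphabet Phi n => contraction_ratio j) isT
  (fun j _ => ltW (ratio_gt0 j n0)).
by exists j.
Qed.

Lemma max_ratio_gt0 n : (0 < n)%N -> 0 < max_ratio n.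
Proof.
by move=> n0; have [j ->] := max_ratio_attained n0; exact: ratio_gt0.
Qed.

Lemma max_ratio_lt1 n : (0 < n)%N -> max_ratio n < 1.
Proof.
by move=> n0; have [j ->] := max_ratio_attained n0; exact: ratio_lt1.
Qed.

Lemma partition_sum_gt0 n m t : (0 < n)%N -> 0 < partition_sum n m t.
Proof.
move=> n0; apply: prodr_gt0 => k _.
by apply: letter_sum_gt0; rewrite addn_gt0 n0.
Qed.

Lemma prod_max_ratio_gt0 n m : (0 < n)%N -> 0 < \prod_(k < m) max_ratio (n + k).
Proof.
move=> n0; apply: prodr_gt0 => k _.
by apply: max_ratio_gt0; rewrite addn_gt0 n0.
Qed.

Lemma prod_max_ratio_nonincreasing n : (0 < n)%N ->
  {homo (fun m => \prod_(k < m) max_ratio (n + k)) :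
    l m / (l <= m)%N >-> m <= l}.
Proof.
move=> n0; apply: homo_leq => [//|x y z /[swap]|m]; first exact: le_trans.
have nm0 : (0 < n + m)%N by rewrite addn_gt0 n0.
rewrite big_ord_recr /= ler_piMr // ltW ?max_ratio_lt1 ?prod_max_ratio_gt0 //.
Qed.

Lemma prod_max_ratio_le1 n m : (0 < n)%N ->
  \prod_(k < m) max_ratio (n + k) <= 1.
Proof.
move=> n0; have := prod_max_ratio_nonincreasing n0 (leq0n m).
by rewrite big_ord0.
Qed.

Lemma prod_max_ratio_lt1 n m : (0 < n)%N -> (0 < m)%N ->
  \prod_(k < m) max_ratio (n + k) < 1.
Proof.
case: m => // m n0 _; rewrite big_ord_recr /=.
have := prod_max_ratio_le1 m n0; have := prod_max_ratio_gt0 m n0.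
have : max_ratio (n + m) < 1 by rewrite max_ratio_lt1 ?addn_gt0 ?n0.
have : 0 < max_ratio (n + m) by rewrite max_ratio_gt0 ?addn_gt0 ?n0.
by nra.
Qed.

Lemma letter_sum_shift n t s : (0 < n)%N -> 0 <= s ->
  letter_sum n (t + s) <= max_ratio n `^ s * letter_sum n t.
Proof.
move=> n0 s0; rewrite /letter_sum mulr_sumr; apply: ler_sum => j _.
have j0 := ratio_gt0 j n0.
rewrite powRD ?(gt_eqF j0) ?implybT // mulrC ler_wpM2r ?powR_ge0 //.
rewrite ge0_ler_powR ?nnegrE ?ratio_le_max ?(ltW j0) //.
by rewrite ltW // max_ratio_gt0.
Qed.

Lemma powR_prod (I : finType) (F : I -> R) s : (forall i, 0 <= F i) ->
  (\prod_i F i) `^ s = \prod_i F i `^ s.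
Proof.
move=> F0.
suff [] : 0 <= \prod_i F i /\ (\prod_i F i) `^ s = \prod_i F i `^ s by [].
elim/big_rec2: _ => [|i x y _ [x0 xy]]; first by rewrite powR1.
by rewrite mulr_ge0 // powRM // xy.
Qed.

(** A quantitative form of strict decrease: the existence of the zero and all comparisons with
    [theta] rest on it. *)
Lemma partition_sum_shift n m t s : (0 < n)%N -> 0 <= s ->
  partition_sum n m (t + s) <=
    (\prod_(k < m) max_ratio (n + k)) `^ s * partition_sum n m t.
Proof.
move=> n0 s0; rewrite powR_prod; last first.
  by move=> k; rewrite ltW // max_ratio_gt0 ?addn_gt0 ?n0.
rewrite /partition_sum -big_split /=; apply: ler_prod => k _.
by rewrite ltW ?letter_sum_gt0 ?letter_sum_shift ?addn_gt0 ?n0.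
Qed.

Lemma continuous_partition_sum n m : (0 < n)%N ->
  continuous (partition_sum n m).
Proof.
move=> n0; apply: continuous_big => [|k _]; first exact: mul_continuous.
apply: continuous_big => [|j _ t]; first exact: add_continuous.
rewrite /powR gt_eqF ?ratio_gt0 ?addn_gt0 ?n0 //.
apply: (@continuous_comp R R R ( *%R^~ (ln (contraction_ratio j))) expR).
  exact: mulrr_continuous.
exact: continuous_expR.
Qed.

Lemma partition_sum0_gt1 n m : (0 < n)%N -> (0 < m)%N ->
  1 < partition_sum n m 0.
Proof.
move=> n0 m0; have -> : 1 = \prod_(k < m) (1 : R) by rewrite big1_eq.
apply: ltr_prod => [|k _].
  by apply/hasP; exists (Ordinal m0); rewrite ?mem_index_enum.
by rewrite ler01 letter_sum0 ltr1n alphabet_ge2 ?addn_gt0 ?n0.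
Qed.

Lemma pressure_zero n m t : (0 < n)%N -> (0 < m)%N ->
  pressure Phi n m t = 0 <-> partition_sum n m t = 1.
Proof.
move=> n0 m0; rewrite pressureE; split => [/eqP|->]; last by rewrite ln1 mulr0.
rewrite mulf_eq0 invr_eq0 pnatr_eq0 -[m == 0]negbK -lt0n m0 /=.
by rewrite ln_eq0 ?partition_sum_gt0 // => /eqP.
Qed.

(** As [theta] is an [xget], a zero must be exhibited: the intermediate value theorem gives one
    between 0, where the sum counts words, and a large exponent [T]. *)
Lemma partition_sum_theta n m : (0 < n)%N -> (0 < m)%N ->
  partition_sum n m (theta Phi n m) = 1.
Proof.
move=> n0 m0; apply/(pressure_zero _ n0 m0).
suff [t0 Zt0] : exists t, partition_sum n m t = 1.
  rewrite /theta; case: xgetP => [t _ //|/(_ t0)[]].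
  exact/(pressure_zero _ n0 m0).
set mu := \prod_(k < m) max_ratio (n + k).
have mu0 : 0 < mu by exact: prod_max_ratio_gt0.
have mu1 : ln mu < 0 by rewrite ln_lt0 // mu0 prod_max_ratio_lt1.
(* [T] is chosen so that [mu] to the power [T] is the inverse of the sum at 0; shifting from 0 to
   [T] then brings the sum down to at most 1. *)
pose T := ln (partition_sum n m 0) / - ln mu.
have Z0 := partition_sum_gt0 m 0 n0.
have T0 : 0 <= T.
  by rewrite divr_ge0 ?ln_ge0 ?(ltW (partition_sum0_gt1 _ _)) // oppr_ge0 ltW.
have ZT : partition_sum n m T <= 1.
  rewrite -[T]add0r; apply: le_trans (partition_sum_shift _ _ n0 T0) _.
  rewrite -/mu /powR gt_eqF // -[X in _ * X](lnK Z0).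
  rewrite -expRD -[leRHS]expR0 ler_expR.
  rewrite /T invrN mulrN mulNr mulfVK ?lt_eqF //; first by rewrite addNr.
have [||t _ Zt] := @IVT R (partition_sum n m) 0 T 1 T0.
- exact/continuous_subspaceT/continuous_partition_sum.
- by rewrite ge_min ZT orbT le_max (ltW (partition_sum0_gt1 _ _)).
by exists t.
Qed.

(** If [t] were below [theta], shifting up by the positive gap would make the sum at [theta]
    strictly less than 1. With [partition_sum_le1], this turns bounds on [theta] into bounds on
    partition sums. *)
Lemma theta_le n m t : (0 < n)%N -> (0 < m)%N ->
  partition_sum n m t <= 1 -> theta Phi n m <= t.
Proof.
move=> n0 m0 Zt; rewrite leNgt; apply/negP => tlt.
have := partition_sum_shift m t n0 (_ : 0 <= theta Phi n m - t).
rewrite subr_ge0 ltW // addrC subrK partition_sum_theta // => /(_ isT).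
rewrite leNgt => /negP; apply.
apply: le_lt_trans (ler_piMr (powR_ge0 _ _) Zt) _.
rewrite -[ltRHS](powRr0 (\prod_(k < m) max_ratio (n + k))).
rewrite /powR gt_eqF ?prod_max_ratio_gt0 // ltr_expR mul0r.
rewrite pmulr_rlt0 ?subr_gt0 // ln_lt0 //.
by rewrite prod_max_ratio_gt0 ?prod_max_ratio_lt1.
Qed.

Lemma partition_sum_le1 n m t : (0 < n)%N -> (0 < m)%N ->
  theta Phi n m <= t -> partition_sum n m t <= 1.
Proof.
move=> n0 m0 tt; rewrite -[t](subrK (theta Phi n m)) addrC.
apply: le_trans (partition_sum_shift _ _ n0 _) _; first by rewrite subr_ge0.
rewrite partition_sum_theta // mulr1.
rewrite -[leRHS](powRr0 (\prod_(k < m) max_ratio (n + k))).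
apply: ger_powR; last by rewrite subr_ge0.
by rewrite prod_max_ratio_gt0 ?prod_max_ratio_le1.
Qed.

Lemma theta_ge0 n m : (0 < n)%N -> (0 < m)%N -> 0 <= theta Phi n m.
Proof.
move=> n0 m0; rewrite leNgt; apply/negP => /ltW /(partition_sum_le1 n0 m0).
rewrite leNgt => /negP; apply; exact: partition_sum0_gt1.
Qed.

(** At the larger of the two zeros, both factors of [partition_sumD] are at most 1. *)
Lemma theta_submax n m k : (0 < n)%N -> (0 < m)%N -> (0 < k)%N ->
  theta Phi n (m + k) <= Num.max (theta Phi n m) (theta Phi (n + m) k).
Proof.
move=> n0 m0 k0; apply: theta_le => //; rewrite ?addn_gt0 ?m0 //.
have nm0 : (0 < n + m)%N by rewrite addn_gt0 n0.
rewrite partition_sumD; apply: mulr_ile1.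
- by rewrite ltW ?partition_sum_gt0.
- by rewrite ltW ?partition_sum_gt0.
- by apply: partition_sum_le1; rewrite // le_max lexx.
- by apply: partition_sum_le1; rewrite // le_max lexx orbT.
Qed.

End PartitionFunction.

(** * Growth of [theta] under uniform bounds on alphabets and ratios *)

Section Growth.
Context (R : realType) (d : nat) (Phi : nonautonomous_IFS R d).
Context (L B : nat) (L_gt0 : (0 < L)%N) (B_gt0 : (0 < B)%N).
Context (card_le_B : forall n, (0 < n)%N -> (#|alphabet Phi n| <= B)%N).
Context (half_L : forall n, (0 < n)%N ->
  \prod_(k < L) max_ratio Phi (n + k) <= 2^-1).

(** Each of the [m %/ L] full blocks of length [L] contributes a factor at most 1/2, and the
    remaining letters a factor at most 1. *)
Lemma prod_max_ratio_le_half n m : (0 < n)%N ->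
  \prod_(k < m) max_ratio Phi (n + k) <= 2^-1 ^+ (m %/ L).
Proof.
move: (m %/ L)%N (m %% L)%N (divn_eq m L) => q s ->.
elim: q n => [|q IH] n n0; first by rewrite mul0n add0n prod_max_ratio_le1.
rewrite mulSn -addnA big_split_ord exprS /=.
have nL0 : (0 < n + L)%N by rewrite addn_gt0 n0.
under [X in _ * X]eq_bigr do rewrite addnA.
by rewrite ler_pM ?half_L ?IH // ltW // prod_max_ratio_gt0.
Qed.

Lemma partition_sum_le_expn n m t : (0 < n)%N -> 0 <= t ->
  partition_sum Phi n m t <= B%:R ^+ m.
Proof.
move=> n0 t0; rewrite -[m in leRHS]card_ord -prodr_const.
apply: ler_prod => k _; have nk0 : (0 < n + k)%N by rewrite addn_gt0 n0.
rewrite ltW ?letter_sum_gt0 // (le_trans (letter_sum_le_card Phi nk0 t0)) //.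
by rewrite ler_nat card_le_B.
Qed.

Lemma theta_increment n n' m k : (0 < n)%N -> (L <= m)%N ->
  (n <= n' <= n + k)%N ->
  theta Phi n (m + k) - theta Phi n' m <= (2 * L * B)%N%:R * (k%:R / m%:R).
Proof.
move=> n0 Lm /andP[nn' n'k]; have m0 : (0 < m)%N by exact: leq_trans Lm.
have n'0 : (0 < n')%N by exact: leq_trans nn'.
rewrite lerBlDl; set dl := _ * (k%:R / _); set th := theta Phi n' m.
have dl0 : 0 <= dl by rewrite mulr_ge0 ?divr_ge0.
have th0 : 0 <= th by exact: theta_ge0.
apply: theta_le => //; first by rewrite addn_gt0 m0.
(* The window of length [m + k] from [n] consists of [a] letters before [n'], the window of
   [theta Phi n' m], and [b] letters after it. *)
have -> : (m + k = (n' - n) + (m + (n + k - n')))%N.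
  by lia.
rewrite !partition_sumD subnKC //.
set a := (n' - n)%N; set b := (n + k - n')%N.
have ab : (a + b = k)%N by rewrite /a /b; lia.
have Zm : partition_sum Phi n' m (th + dl) <= 2^-1 ^+ (B * k).
  apply: le_trans (partition_sum_shift Phi _ _ n'0 dl0) _.
  rewrite partition_sum_theta // mulr1.
  apply: (@le_trans _ _ ((2^-1 ^+ (m %/ L)) `^ dl)).
    rewrite ge0_ler_powR ?nnegrE ?exprn_ge0 ?prod_max_ratio_le_half //.
    by rewrite ltW // prod_max_ratio_gt0.
  rewrite -!powR_mulrn // -powRrM.
  apply: ger_powR; first by apply/andP; split; lra.
  rewrite /dl mulrA mulrA -natrM ler_pdivlMr ?ltr0n // -!natrM ler_nat.
  (* Since [m >= L], rounding in [m %/ L] loses less than a factor 2, which explains the 2 in the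
     constant. *)
  have mq : (m <= m %/ L * (2 * L))%N.
    have qL : (0 < m %/ L)%N by rewrite divn_gt0.
    by have := divn_eq m L; have := ltn_pmod m L_gt0; nia.
  by rewrite -(mulnA (2 * L)%N) mulnA mulnC leq_mul.
have tdl : 0 <= th + dl by rewrite addr_ge0.
have Za := partition_sum_le_expn a n0 tdl.
have n'm : (0 < n' + m)%N by rewrite addn_gt0 n'0.
have Zb := partition_sum_le_expn b n'm tdl.
apply: (@le_trans _ _ (B%:R ^+ a * (2^-1 ^+ (B * k) * B%:R ^+ b))).
  have Z0 l q : (0 < l)%N -> 0 <= partition_sum Phi l q (th + dl).
    by move=> l0; exact/ltW/partition_sum_gt0.
  by rewrite !ler_pM ?mulr_ge0 ?Z0.
(* The bound equals [(B / 2 ^ B) ^ k], and [B < 2 ^ B]. *)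
rewrite mulrCA -exprD ab exprM -exprMn exprn_ile1 ?mulr_ge0 ?exprn_ge0 //.
rewrite exprVn mulrC ler_pdivrMr ?exprn_gt0 // mul1r -natrX ler_nat.
by rewrite ltnW // ltn_expl.
Qed.

End Growth.

(** * Composition of maps and the Euclidean distance *)

Lemma big_comp_ord_recr (T : Type) n (F : 'I_n.+1 -> T -> T) :
  \big[(fun f g => f \o g)/id]_(k < n.+1) F k =
  \big[(fun f g => f \o g)/id]_(k < n) F (widen_ord (leqnSn n) k) \o F ord_max.
Proof.
(* Splitting off the innermost map uses associativity, so composition is packed as a monoid law. *)
pose law : Monoid.law (@id T) := HB.pack (fun f g : T -> T => f \o g)
  (Monoid.isLaw.Build (T -> T) id (fun f g : T -> T => f \o g)
    (fun _ _ _ => erefl) (fun=> erefl) (fun=> erefl)).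
exact: (@big_ord_recr _ _ law).
Qed.

Section EuclideanDistance.
Context (R : realType) (d : nat).
Implicit Types (x y z : 'cV[R]_d) (e a : R).

Lemma eucl_distE x y :
  eucl_dist x y = Num.sqrt (((x - y)^T *m (x - y)) ord0 ord0).
Proof.
rewrite /eucl_dist mxE; congr Num.sqrt; apply: eq_bigr => i _.
by rewrite !mxE expr2.
Qed.

Lemma eucl_dist_similarity a (O : 'M[R]_d) b x y :
  0 <= a -> O^T *m O = 1%:M ->
  eucl_dist (a *: (O *m x) + b) (a *: (O *m y) + b) = a * eucl_dist x y.
Proof.
move=> a0 OO; rewrite !eucl_distE.
have -> : a *: (O *m x) + b - (a *: (O *m y) + b) = a *: (O *m (x - y)).
  by rewrite opprD addrACA subrr addr0 -scalerBr -mulmxBr.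
have -> (v : 'cV[R]_d) :
    (a *: (O *m v))^T *m (a *: (O *m v)) = (a * a) *: (v^T *m v).
  rewrite [(a *: _)^T]linearZ /= -scalemxAl -scalemxAr scalerA.
  by rewrite trmx_mul mulmxA -(mulmxA _ O^T) OO mulmx1.
by rewrite mxE sqrtrM ?mulr_ge0 // -expr2 sqrtr_sqr ger0_norm.
Qed.

(** [ball] is that of the sup norm, which would give the factor [sqrt d]; the cruder [d.+1] avoids
    the root and is never 0. *)
Lemma eucl_dist_ball e x y : ball x e y -> eucl_dist x y <= d.+1%:R * e.
Proof.
case=> e0 xy; have -> : d.+1%:R * e = Num.sqrt ((d.+1%:R * e) ^+ 2).
  by rewrite sqrtr_sqr ger0_norm // mulr_ge0 // ltW.
rewrite /eucl_dist ler_sqrt ?sqr_ge0 //.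
apply: (@le_trans _ _ (\sum_(i < d) e ^+ 2)).
  apply: ler_sum => i _; rewrite -real_normK ?num_real //.
  have xyi : `|x i ord0 - y i ord0| < e := xy i ord0.
  by rewrite ler_pXn2r ?nnegrE // ltW.
rewrite sumr_const card_ord exprMn -[leLHS]mulr_natl ler_wpM2r ?sqr_ge0 //.
by rewrite -natrX ler_nat -mulnn (leq_trans (leqnSn d)) // leq_pmulr.
Qed.

Lemma ball_eucl_dist e x y : eucl_dist x y < e -> ball x e y.
Proof.
move=> xy; split; first by apply: le_lt_trans xy; exact: sqrtr_ge0.
move=> i j; rewrite ord1; apply: le_lt_trans xy.
rewrite -sqrtr_sqr ler_sqrt ?sumr_ge0 // => [|k _]; last exact: sqr_ge0.
by rewrite (bigD1 i) //= lerDl sumr_ge0 // => k _; exact: sqr_ge0.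
Qed.

Lemma lipschitz_eucl_continuous (f : 'cV[R]_d -> 'cV[R]_d) a :
  (forall x y, eucl_dist (f x) (f y) <= a * eucl_dist x y) -> continuous f.
Proof.
move=> fa x; apply/(@cvg_ballP R _ _ (nbhs x)) => e e0.
(* [|a| + 1] is positive and bounds [a]; with this [c], the ball of radius [e / (2 * c)] is mapped
   within Euclidean distance [e / 2]. *)
pose c := (`|a| + 1) * d.+1%:R.
have c0 : 0 < c by rewrite mulr_gt0 // ltr_wpDl.
have ec0 : 0 < e / (2 * c) by rewrite divr_gt0 ?mulr_gt0.
have := @nbhsx_ballx _ _ x (e / (2 * c)) ec0.
apply: filterS => y /eucl_dist_ball xy.
apply: ball_eucl_dist; apply: (le_lt_trans (fa x y)).
apply: (@le_lt_trans _ _ ((`|a| + 1) * (d.+1%:R * (e / (2 * c))))).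
  apply: (le_trans (ler_wpM2r (sqrtr_ge0 _) (_ : a <= `|a| + 1))).
    by rewrite (le_trans (ler_norm a)) // lerDl.
  by rewrite ler_wpM2l // addr_ge0.
have -> : (`|a| + 1) * (d.+1%:R * (e / (2 * c))) = e / 2.
  rewrite (mulrA (`|a| + 1)) -/c [c * _]mulrC invfM -!mulrA.
  by rewrite mulVf ?mulr1 // gt_eqF.
by rewrite ltr_pdivrMr // ltr_pMr // ltr1n.
Qed.

Lemma compact_small_cover (X : set 'cV[R]_d) e : compact X -> 0 < e ->
  exists F : {fset ('cV[R]_d)},
    forall x, X x -> exists2 z, z \in F & ball z e x.
Proof.
move=> Xc e0; have := Xc; rewrite compact_cover.
move=> /(_ _ setT (fun z => (ball z e)^°)) [z _||F _ XF].
- exact: open_interior.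
- by move=> x Xx; exists x => //; exact: nbhsx_ballx.
by exists F => x /XF [z zF /interior_subset]; exists z.
Qed.

End EuclideanDistance.

(** * The coding map and cuts of the symbolic space *)

Section Coding.
Context (R : realType) (d : nat) (Phi : nonautonomous_IFS R d).
Implicit Types (i : Delta Phi) (r : R).

Local Notation X := (seed Phi).

Lemma init_wordE i n (k : 'I_n) : init_word i n k = i k.
Proof. by rewrite ffunE. Qed.

Lemma parent_init_word i n : parent (init_word i n.+1) = init_word i n.
Proof. by apply/ffunP => k; rewrite !ffunE. Qed.

Lemma rho_init_word i n :
  rho (init_word i n) = \prod_(k < n) contraction_ratio (i k).
Proof. by apply: eq_bigr => k _; rewrite init_wordE. Qed.

Lemma sim_word_init_wordS i n x :
  sim_word (init_word i n.+1) x = sim_word (init_word i n) (sim (i n) x).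
Proof.
rewrite /sim_word big_comp_ord_recr /= init_wordE.
set f := \big[_/_]_(k < n) _; set g := \big[_/_]_(k < n) _.
suff -> : f = g by [].
by apply: eq_bigr => k _; rewrite !init_wordE.
Qed.

Lemma rho_init_word_gt0 i n : 0 < rho (init_word i n).
Proof. by rewrite rho_init_word prodr_gt0 // => k _; rewrite ratio_gt0. Qed.

Lemma rho_init_word_nonincreasing i :
  {homo (fun n => rho (init_word i n)) : m n / (m <= n)%N >-> n <= m}.
Proof.
apply: homo_leq => [//|x y z /[swap]|n]; first exact: le_trans.
rewrite !rho_init_word big_ord_recr /= ler_piMr //.
  by rewrite -rho_init_word ltW // rho_init_word_gt0.
by rewrite ltW // ratio_lt1.
Qed.

Lemma eucl_dist_sim_word i n x y :
  eucl_dist (sim_word (init_word i n) x) (sim_word (init_word i n) y) =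
    rho (init_word i n) * eucl_dist x y.
Proof.
elim: n x y => [|n IH] x y.
  by rewrite rho_init_word /sim_word !big_ord0 mul1r.
rewrite !sim_word_init_wordS IH eucl_dist_similarity ?orth_orthogonal //.
  2: by rewrite ltW // ratio_gt0.
by rewrite mulrA !rho_init_word big_ord_recr.
Qed.

Lemma sim_word_continuous i n : continuous (sim_word (init_word i n)).
Proof.
apply: (@lipschitz_eucl_continuous _ _ _ (rho (init_word i n))) => x y.
by rewrite eucl_dist_sim_word.
Qed.

Lemma sim_word_seed_nonincreasing i m n : (m <= n)%N ->
  sim_word (init_word i n) @` X `<=` sim_word (init_word i m) @` X.
Proof.
elim: n => [|n IH]; first by rewrite leqn0 => /eqP ->.
rewrite leq_eqVlt => /predU1P[-> //|/IH]; apply: subset_trans.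
move=> _ [x Xx <-]; rewrite sim_word_init_wordS; exists (sim (i n) x) => //.
by apply: (@seed_stable _ _ Phi _ (i n)) => //; exists x.
Qed.

(** The point chosen by [coding] lies in the intersection once this is nonempty. A cluster point of
    the images of one seed point belongs to every member of the nested family of compact sets. *)
Lemma coding_in i n : (0 < n)%N ->
  (sim_word (init_word i n) @` X) (coding i).
Proof.
suff [p Xp] : (\bigcap_(n in [set n | (0 < n)%N])
            (sim_word (init_word i n) @` X)) !=set0.
  by rewrite /coding => n0; case: xgetP => [y _|/(_ p)//]; apply.
have [x0 Xx0] := seed_neq0 Phi.
pose u n := sim_word (init_word i n) x0.
have uX m : (\forall k \near \oo, (sim_word (init_word i m) @` X) (u k)).
  by exists m => // k /= nk; apply: (sim_word_seed_nonincreasing nk); exists x0.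
have [|p [_ up]] := @seed_compact _ _ Phi (u @ \oo) _.
  (* The word of length 0 acts as the identity, so [uX 0] places the sequence in the seed. *)
  move: (uX 0%N); apply: filterS => k [y Xy].
  by move: Xy; rewrite /sim_word big_ord0 /= => Xy <-.
exists p => k /= _.
have : closed (sim_word (init_word i k) @` X).
  apply: compact_closed; first exact: norm_hausdorff.
  apply: continuous_compact; last exact: (@seed_compact _ _ Phi).
  exact/continuous_subspaceT/sim_word_continuous.
by apply => B Bp; apply: up => //; exact: uX.
Qed.

Lemma coding_limit_set i : limit_set Phi (coding i).
Proof.
by move=> n /= n0; exists (init_word i n) => //; exact: coding_in.
Qed.

Lemma rho_init_word_small r : 0 < r ->
  exists n, forall i, rho (init_word i n) <= r.
Proof.
move=> r0; have /cvgrPdist_lt/(_ _ r0)[N _] := sup_rho_cvg0 Phi.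
move=> /(_ N (leqnn N)) /=; rewrite sub0r normrN => supr; exists N => i.
apply: le_trans (ltW supr); apply: le_trans (ler_norm _).
(* [sup] dominates its set only if that set has an upper bound; here 1 is one. *)
apply: ub_le_sup; last by exists (init_word i N).
exists 1 => _ [w _ <-]; apply: prodr_ile1 => k _.
by rewrite !ltW ?ratio_gt0 ?ratio_lt1.
Qed.

Lemma cut_exists r : 0 < r < 1 -> exists c : Delta Phi -> nat, forall i,
  [/\ (0 < c i)%N, rho (init_word i (c i)) <= r &
      forall k, (k < c i)%N = (r < rho (init_word i k))].
Proof.
move=> /andP[r0 r1]; have [N rN] := rho_init_word_small r0.
pose c i := ex_minn (ex_intro (fun n => rho (init_word i n) <= r) N (rN i)).
exists c => i; rewrite /c; case: ex_minnP => n rn minn; split => //.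
  by case: n rn {minn} => //; rewrite rho_init_word big_ord0 leNgt r1.
move=> k; apply/idP/idP => [kn|].
  by rewrite ltNge; apply: contraTN kn => /minn; rewrite -leqNgt.
rewrite !ltnNge ltNge; apply: contraNN => nk; apply: le_trans rn.
exact: rho_init_word_nonincreasing.
Qed.

End Coding.

(** * Counting cylinders near a point *)

Section Counting.
Context (R : realType) (d : nat) (Phi : nonautonomous_IFS R d).
Implicit Types (i : Delta Phi) (r : R).

(** A limsup below [+oo] yields one neighbourhood of 0 on which the supremum [M] is below [+oo]. The
    bound is put in terms of finite injective families, the form in which descendants are counted
    later. *)
Lemma bounded_nbhd_cylinders : bounded_neighbourhood_condition Phi ->
  exists N : nat, exists2 r0 : R, 0 < r0 &
    forall (S : finType) (Q : S -> cylinder Phi) x r, injective Q ->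
      limit_set Phi x -> 0 < r < r0 -> (forall s, nbhd_cylinders x r (Q s)) ->
      (#|S| <= N)%N.
Proof.
rewrite /bounded_neighbourhood_condition /limf_esup.
move=> /ereal_inf_lt[_ [V V0 <-]].
set M := ereal_sup _ => Moo.
have [r0 r00 Vr0] : exists2 r0 : R, 0 < r0 & forall r, 0 < r < r0 -> V r.
  have [e /= e0 Ve] := V0; exists e => // r /andP[rr re]; apply: Ve => //=.
  by rewrite sub0r normrN gtr0_norm.
exists (Num.truncn (fine M)); exists r0 => // S Q x r Qinj xK rr QN.
have countM : (counting (@nbhd_cylinders _ _ Phi x r) <= M)%E.
  apply: (@le_trans _ _ (ereal_sup
    [set counting (@nbhd_cylinders _ _ Phi x r) | x in limit_set Phi])).
    by apply: ereal_sup_ubound; exists x.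
  by apply: ereal_sup_ubound; exists r => //; exact: Vr0.
move: countM; rewrite /counting.
case: asboolP => [fin|_]; last by rewrite leNgt Moo.
case: M Moo => [M _||] //; rewrite lee_fin /= => cM.
rewrite truncn_ge_nat; last exact: le_trans cM.
apply: le_trans cM; rewrite ler_nat cardE -(size_map Q).
apply: uniq_leq_size; first by rewrite map_inj_uniq ?enum_uniq.
by move=> _ /mapP[s _ ->]; rewrite in_fset_set //; exact: mem_set.
Qed.

(* Points of the p-th cylinder of [i] that separate from each other at a scale
   above half its ratio lie in distinct elements of the cut at that half. *)
Lemma fork_count : bounded_neighbourhood_condition Phi ->
  exists B : nat, exists2 r0 : R, 0 < r0 &
    forall (S : finType) (f : S -> Delta Phi) i p,
      (0 < p)%N -> rho (init_word i p) < r0 ->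
      (forall s k, (k < p)%N -> f s k = i k) ->
      (forall s s', s != s' -> exists2 k, f s k <> f s' k &
         rho (init_word i p) / 2 < rho (init_word (f s) k)) ->
      (#|S| <= B)%N.
Proof.
move=> /bounded_nbhd_cylinders[N [r0 r00 Nr0]].
(* Two points of a ball of radius [e] are at Euclidean distance at most 1/2. *)
pose e : R := (4 * d.+1%:R)^-1.
have e0 : 0 < e by rewrite invr_gt0 mulr_gt0.
have [F FX] := compact_small_cover (@seed_compact _ _ Phi) e0.
(* The points are sorted by the ball of the cover that contains their seed point, with at most [N]
   in each class; the minimum with 1 keeps [r] in the range of [cut_exists]. *)
exists (#|` F| * N)%N; exists (Num.min r0 1).
  by rewrite lt_min r00 ltr01.
move=> S f i p p0; rewrite lt_min => /andP[rho0 rho1] fi fork.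
have rhop := rho_init_word_gt0 i p.
set r := rho (init_word i p) / 2 in fork.
have rlt : r < rho (init_word i p) by rewrite /r; lra.
have r01 : 0 < r < 1 by rewrite /r; apply/andP; split; lra.
have rr0 : 0 < r < r0 by rewrite /r; apply/andP; split; lra.
have [c cP] := cut_exists Phi r01.
have init_f s : init_word (f s) p = init_word i p.
  by apply/ffunP => k; rewrite !ffunE fi.
pose Q s : cylinder Phi := existT _ (c (f s)) (init_word (f s) (c (f s))).
have Qinj : injective Q.
  (* The ratio at the fork [k] exceeds [r], so [k] lies before the cut and equal words would agree
     there. Going through [cylinder_set] avoids a cast between words of different lengths. *)
  move=> s s' QQ; apply: contrapT => /eqP /fork [k fk].
  have [_ _ <-] := cP (f s) => kc; apply: fk.
  have : cylinder_set (Q s) (f s') by rewrite QQ.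
  move=> /ffunP/(_ (Ordinal kc)) /=.
  by rewrite !ffunE.
have code s : exists xz : 'cV[R]_d * F,
    [/\ seed Phi xz.1, coding (f s) = sim_word (init_word i p) xz.1 &
         ball (val xz.2) e xz.1].
  have [x Xx xf] := coding_in (f s) p0; have [z zF zx] := FX _ Xx.
  by exists (x, [` zF]%fset); split => //=; rewrite -(init_f s).
have [g gP] := choice code.
(* Seed points in one ball are at distance at most 1/2, so their images under the common p-th map
   are at distance at most [r]: all cylinders of the fibre meet one closed ball of radius [r]. *)
have fibre (z : F) : (#|[set s | (g s).2 == z]%SET| <= N)%N.
  have [->|[s0]] := set_0Vmem [set s | (g s).2 == z]%SET.
    by rewrite cards0.
  rewrite inE => /eqP gs0; rewrite cardsE -card_sig.
  apply: (Nr0 _ (fun s => Q (val s)) (coding (f s0)) r) => //.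
  - by move=> s s' /Qinj /val_inj.
  - exact: coding_limit_set.
  case=> s gsz; have gs : (g s).2 = z by exact/eqP/gsz.
  have [c0 cr cn] := cP (f s).
  split.
    split => //=; move: c0 cr (cn (c (f s)).-1).
    by case: (c (f s)) => // n _ _; rewrite parent_init_word ltnSn => <-.
  exists (coding (f s)); split; first by exists (f s).
  have [_ -> b0] := gP s0; have [_ -> b1] := gP s.
  rewrite /eucl_closed_ball /= eucl_dist_sim_word /r ler_pM2l //.
  rewrite gs0 in b0; rewrite gs in b1.
  apply: (le_trans (eucl_dist_ball (ball_triangle (ball_sym b0) b1))).
  have D0 : d.+1%:R != 0 :> R by rewrite pnatr_eq0.
  have -> : e + e = d.+1%:R^-1 / 2.
    by rewrite /e invfM; move: (_ d.+1%:R) => u; lra.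
  by rewrite mulrA mulfV // mul1r.
rewrite -sum1_card (partition_big (fun s => (g s).2) predT) //=.
apply: (@leq_trans (\sum_(z : F) N)).
  by apply: leq_sum => z _; rewrite sum1_card; move: (fibre z); rewrite cardsE.
by rewrite sum_nat_const cardfE.
Qed.

End Counting.

(** * Uniform bounds on alphabets and on the decay of ratios *)

Section UniformBounds.
Context (R : realType) (d : nat) (Phi : nonautonomous_IFS R d).

Definition change_letter (i : Delta Phi) p (j : alphabet Phi (1 + p)) :
    Delta Phi :=
  @dfwith _ (fun k => alphabet Phi (1 + k)) i p j.

Lemma change_letter_in i p (j : alphabet Phi (1 + p)) : change_letter i j p = j.
Proof. exact: dfwithin. Qed.

Lemma change_letter_out i p (j : alphabet Phi (1 + p)) k :
  p != k -> change_letter i j k = i k.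
Proof. exact: dfwithout. Qed.

Lemma init_word_change_letter i p (j : alphabet Phi (1 + p)) n : (n <= p)%N ->
  init_word (change_letter i j) n = init_word i n.
Proof.
move=> np; apply/ffunP => k; rewrite !ffunE change_letter_out //.
by rewrite gtn_eqF // (leq_trans (ltn_ord k)).
Qed.

Context (bnc : bounded_neighbourhood_condition Phi).

Lemma uniform_bounds : exists L B : nat,
  [/\ (0 < L)%N, (0 < B)%N,
    forall n, (0 < n)%N -> (#|alphabet Phi n| <= B)%N &
    forall n, (0 < n)%N -> \prod_(k < L) max_ratio Phi (n + k) <= 2^-1].
Proof.
have [B [r0 r00 forkB]] := fork_count bnc.
(* Along a branch of maximal letters, the ratios are products of [max_ratio], so a bound on this
   single branch controls all words. *)
have [i imax] : exists i : Delta Phi,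
    forall k, max_ratio Phi k.+1 = contraction_ratio (i k).
  exists (fun k => projT1 (cid (@max_ratio_attained R d Phi k.+1 isT))) => k.
  exact: projT2 (cid (@max_ratio_attained R d Phi k.+1 isT)).
have [q rhoq] := rho_init_word_small Phi (divr_gt0 r00 (ltr0n _ 2)).
(* The successor ensures [0 < p] for every [p >= p0], as [fork_count] requires. *)
pose p0 := q.+1.
have rho_p p : (p0 <= p)%N -> rho (init_word i p) < r0.
  move=> /ltnW qp; apply: (le_lt_trans (rho_init_word_nonincreasing i qp)).
  by apply: (le_lt_trans (rhoq i)); lra.
have half p : 0 < rho (init_word i p) / 2 < rho (init_word i p).
  by have := rho_init_word_gt0 i p; lra.
have far_card p : (p0 <= p)%N -> (#|alphabet Phi p.+1| <= B)%N.
  move=> p0p.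
  apply: (forkB _ (fun j : alphabet Phi p.+1 => @change_letter i p j) i p).
  - exact: leq_trans p0p.
  - exact: rho_p.
  - by move=> j k kp; rewrite change_letter_out // gtn_eqF.
  move=> j j' /eqP jj'; exists p; first by rewrite !change_letter_in.
  by rewrite init_word_change_letter //; case/andP: (half p).
have other k : exists j : alphabet Phi (1 + k), j <> i k.
  have : (0 < #|predC1 (i k)|)%N.
    by rewrite cardC1 -ltnS prednK ?alphabet_ge2 // ltnW // alphabet_ge2.
  by move=> /card_gt0P[j /eqP]; exists j.
pose o k := projT1 (cid (other k)).
have oP k : o k <> i k := projT2 (cid (other k)).
(* Otherwise the branch stays above half its ratio for [B.+1] steps, and leaving it at each of them
   through the letter [o] gives [B.+1] forking points. *)
have far_half p : (p0 <= p)%N ->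
    \prod_(k < B.+1) max_ratio Phi (p.+1 + k) <= 2^-1.
  move=> p0p; rewrite leNgt; apply/negP => gt_half.
  suff : (#|'I_B.+1| <= B)%N by rewrite card_ord ltnn.
  have big k : (k <= B)%N ->
      rho (init_word i p) / 2 < rho (init_word i (p + k)).
    move=> kB; have -> : rho (init_word i (p + k)) =
        rho (init_word i p) * \prod_(l < k) max_ratio Phi (p.+1 + l).
      rewrite !rho_init_word big_split_ord; congr (_ * _).
      by apply: eq_bigr => l _; rewrite imax.
    rewrite ltr_pM2l ?rho_init_word_gt0 // (lt_le_trans gt_half) //.
    exact: (prod_max_ratio_nonincreasing _ (ltn0Sn p) (leqW kB)).
  apply: (forkB _ (fun s : 'I_B.+1 => change_letter i (o (p + s)%N)) i p).
  - exact: leq_trans p0p.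
  - exact: rho_p.
  - by move=> s k kp; rewrite change_letter_out // gtn_eqF // ltn_addr.
  (* Two such points separate where the earlier one departs: there it carries [o], while the other
     still follows [i]. *)
  move=> s s' ss'; exists (p + minn s s')%N; last first.
    rewrite init_word_change_letter ?leq_add2l ?geq_minl //; apply: big.
    by rewrite (leq_trans (geq_minl _ _)) // -ltnS.
  have [lt|lt|/val_inj eq] := ltngtP s s'; last by rewrite eq eqxx in ss'.
  - rewrite change_letter_in change_letter_out; first exact: oP.
    by rewrite eqn_add2l gtn_eqF.
  - rewrite change_letter_in change_letter_out.
      by move=> /esym; exact: oP.
    by rewrite eqn_add2l gtn_eqF.
(* The first [p0] letters of a word only serve to reach levels where [far_half] applies, at a factor
   at most 1. The alphabets of the first [p0] levels are bounded by their total size. *)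
exists (p0 + B.+1)%N, (\sum_(k < p0) #|alphabet Phi k.+1| + B).+1; split => //.
  case=> // p _; have [pp0|/far_card le] := ltnP p p0.
    rewrite (bigD1 (Ordinal pp0)) //= -!addnA ltnW // ltnS leq_addr //.
  by rewrite (leq_trans le) // leqW // leq_addl.
case=> // p _; rewrite big_split_ord /=.
have := prod_max_ratio_le1 Phi p0 (ltn0Sn p).
have := prod_max_ratio_gt0 Phi p0 (ltn0Sn p).
have := far_half (p + p0)%N (leq_addl _ _).
have := prod_max_ratio_gt0 Phi B.+1 (ltn0Sn (p + p0)).
rewrite -addSn.
under [X in _ -> _ -> _ -> _ -> _ * X <= _]eq_bigr do rewrite addnA.
by nra.
Qed.

End UniformBounds.

Theorem lemma4p2 (R : realType) (d : nat) (d_gt0 : (0 < d)%N)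
    (Phi : nonautonomous_IFS R d) :
  (forall n m k : nat, (0 < n)%N -> (0 < m)%N -> (0 < k)%N ->
     theta Phi n (m + k) <= Num.max (theta Phi n m) (theta Phi (n + m) k))
  /\
  (bounded_neighbourhood_condition Phi ->
     (exists C : R, 0 < C /\
        exists M : nat, (0 < M)%N /\
          forall n n' m k : nat,
            (0 < n)%N -> (0 < n')%N -> (0 < m)%N -> (0 < k)%N ->
            (M <= m)%N -> (n <= n' <= n + k)%N ->
            theta Phi n (m + k) - theta Phi n' m <= C * (k%:R / m%:R))
     /\
     submaximal (fun n m : nat => (theta Phi n m)%:E)).
Proof.
split; first exact: theta_submax.
move=> /uniform_bounds[L [B [L0 B0 cardB halfL]]].
have increment n n' m k :=
  @theta_increment R d Phi L B L0 B0 cardB halfL n n' m k.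
have C0 : 0 < (2 * L * B)%N%:R :> R by rewrite ltr0n !muln_gt0 L0 B0.
split.
  exists (2 * L * B)%N%:R; split=> //.
  by exists L; split=> // n n' m k n0 _ _ _; exact: increment.
split=> [//|x y z x0 y0 z0|eps a eps0 a0].
  by rewrite -EFin_max lee_fin theta_submax.
pose C : R := (2 * L * B)%N%:R.
(* For [y] beyond this bound, [C * t / y <= C * a / y <= eps]; the summand [L] makes the increment
   bound available. *)
exists (L + Num.bound (C * a%:R / eps))%N; first by rewrite addn_gt0 L0.
move=> x x' y t x0 x'0 y0 t0 Ny ta xx'.
have Ly : (L <= y)%N by apply: leq_trans Ny; rewrite leq_addr.
rewrite -EFinD lee_fin addrC -lerBlDr.
apply: (le_trans (increment _ _ _ _ x0 Ly xx')); rewrite -/C.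
rewrite mulrA ler_pdivrMr ?ltr0n //.
apply: (@le_trans _ _ (C * a%:R)); first by rewrite ler_pM2l // ler_nat.
rewrite -ler_pdivrMl // mulrC.
have /archi_boundP/ltW/le_trans : 0 <= C * a%:R / eps.
  by rewrite divr_ge0 ?mulr_ge0 // ltW.
by apply; rewrite ler_nat (leq_trans _ Ny) // leq_addl.
Qed.
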